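(* Let $q$ be a prime, $\delta=\log_2 q$, and $n$ a power of two. In the cell-probe model with $w$ bits per cell, any algorithm solving the online convolution problem on a vector $V$ and an input sequence $\Delta=(\Delta_0,\dots,\Delta_{n-1})$, both chosen uniformly at random from $[q]^n$, runs in $\Omega\left(\frac{\delta}{w}n\log n\right)$ expected time over the $n$ operations $\mathrm{next}(\Delta_0),\dots,\mathrm{next}(\Delta_{n-1})$.
   Context: $[q]=\{0,\dots,q-1\}$. Online convolution problem with fixed vector $V\in[q]^n$: maintain $A\in[q]^n$, initially all zeros; $\mathrm{next}(\Delta)$ replaces $A$ by $(A[1],\dots,A[n-1],\Delta)$ and returns $\langle A,V\rangle=\sum_iA[i]V[i]\bmod q$ before the next input arrives. Cell-probe model: memory of cells of $w$ bits (each cell can hold the address of any cell); computation free, no state between operations except memory; time = number of cell reads/writes. *)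

(* Defs.v *)
From mathcomp Require Import all_boot all_order all_algebra.
From mathcomp Require Import reals exp.

Set Implicit Arguments.
Unset Strict Implicit.
Unset Printing Implicit Defensive.

Import Order.TTheory GRing.Theory Num.Theory.

Definition word (w : nat) := w.-tuple bool.

Definition memory (m w : nat) := {ffun 'I_m -> word w}.

Definition set_cell (m w : nat) (s : memory m w) (a : 'I_m) (x : word w) :
  memory m w := [ffun b => if b == a then x else s b].

(* Since computation is free, the code of one operation is an arbitrary
   decision tree: what it does next is any function of the argument of the
   operation and of the words read so far during that operation. *)
Inductive program (m w : nat) (B : Type) : Type :=
| Return of B
| Read of 'I_m & (word w -> program m w B)
| Write of 'I_m & word w & program m w B.

(* Result, final memory and number of probes (reads and writes). *)
Fixpoint exec (m w : nat) (B : Type) (p : program m w B) (s : memory m w) :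
  B * memory m w * nat :=
  match p with
  | Return b => (b, s, 0)
  | Read a k => let: (b, s', t) := exec (k (s a)) s in (b, s', t.+1)
  | Write a x p' => let: (b, s', t) := exec p' (set_cell s a x) in (b, s', t.+1)
  end.

(* [cells_le] says that a [w]-bit word can hold any address.  The code [step]
   of an operation depends only on its argument, so that the memory is the only
   state kept from one operation to the next. *)
Record algorithm (q w : nat) := Algorithm {
  cells : nat;
  cells_le : cells <= 2 ^ w;
  init : memory cells w;
  step : 'I_q -> program cells w 'I_q
}.

(* Outputs and total number of probes over a sequence of operations. *)
Fixpoint run_from (q w : nat) (alg : algorithm q w) (s : memory (cells alg) w)
  (ds : seq 'I_q) : seq 'I_q * nat :=
  if ds is d :: ds' then
    let: (y, s', t) := exec (step alg d) s in
    let: (ys, t') := run_from s' ds' in (y :: ys, t + t')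
  else ([::], 0).

Definition run (q w : nat) (alg : algorithm q w) (ds : seq 'I_q) :=
  run_from (init alg) ds.

Definition outputs (q w : nat) (alg : algorithm q w) (ds : seq 'I_q) :
  seq 'I_q := (run alg ds).1.

Definition time (q w : nat) (alg : algorithm q w) (ds : seq 'I_q) : nat :=
  (run alg ds).2.

Definition inner (q n : nat) (A : seq nat) (V : n.-tuple 'I_q) : nat :=
  (\sum_(i < n) nth 0 A i * tnth V i) %% q.

Fixpoint convolution_from (q n : nat) (V : n.-tuple 'I_q) (A : seq nat)
  (ds : seq 'I_q) : seq nat :=
  if ds is d :: ds' then
    let A' := rcons (behead A) (d : nat) in
    inner A' V :: convolution_from V A' ds'
  else [::].

Definition convolution (q n : nat) (V : n.-tuple 'I_q) (ds : seq 'I_q) :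
  seq nat := convolution_from V (nseq n 0) ds.

Definition solves (q n w : nat) (alg : algorithm q w) (V : n.-tuple 'I_q) :
  Prop :=
  forall D : n.-tuple 'I_q,
    [seq nat_of_ord y | y <- outputs alg D] = convolution V D.

Local Open Scope ring_scope.

Definition log2 (R : realType) (x : R) : R := ln x / ln 2.

(* [V] is fixed in the online problem, so that an algorithm may depend on it
   arbitrarily, both in its code and in the initial contents of its memory: it
   is given as a family indexed by [V].  The expectation is over [V] and the
   input sequence, uniform and independent. *)
Definition expected_time (R : realType) (q n w : nat)
  (alg : n.-tuple 'I_q -> algorithm q w) : R :=
  (\sum_(V : n.-tuple 'I_q) \sum_(D : n.-tuple 'I_q) (time (alg V) D)%:R)
    / (#|{: n.-tuple 'I_q}| * #|{: n.-tuple 'I_q}|)%:R.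

(* Main.v *)
(* Information transfer by counting. For a node of the binary tree of operations
   whose left and right subtrees L and R have l leaves each, the outputs during R
   depend on the inputs of L only through the cells written during L and read
   during R before being overwritten. A memory that differs from a fixed one in at
   most k cells can take at most 8^(w k) values, since w-bit words hold both
   addresses and contents. On the other hand, a fixed output sequence is reached by
   at most |ker T| inputs of L, where T is an l x l Toeplitz matrix with entries
   from V. A nonzero vector is in ker T with probability q^(-l), so E|ker T| < 2
   and |ker T|^2 <= q^l for a constant fraction of the V. For these V, at least
   half of the inputs of L transfer more than l log q / (9 w) cells, whatever the
   other inputs are. The transfers of all nodes are bounded by the number of reads,
   and each of the log n levels contributes order of n log q / w. *)
Require Import Defs.
From mathcomp Require Import all_boot all_order all_algebra.
From mathcomp Require Import reals exp.
From mathcomp Require Import zify ring.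

Set Implicit Arguments.
Unset Strict Implicit.
Unset Printing Implicit Defensive.

Import Order.TTheory GRing.Theory Num.Theory.

(** * Footprint of a single program: cells it depends on and cells it changes *)

Section Programs.
Variables m w : nat.
Implicit Types s : memory m w.

Definition result B (p : program m w B) s : B := (exec p s).1.1.
Definition final B (p : program m w B) s : memory m w := (exec p s).1.2.
Definition cost B (p : program m w B) s : nat := (exec p s).2.

(* The cells whose content before the execution of [p] is seen by [p]. *)
Fixpoint exposed B (p : program m w B) s : {set 'I_m} :=
  match p with
  | Return _ => set0
  | Read a k => a |: exposed (k (s a)) s
  | Write a x p' => exposed p' (set_cell s a x) :\ a
  end.

Fixpoint written B (p : program m w B) s : {set 'I_m} :=
  match p with
  | Return _ => set0
  | Read a k => written (k (s a)) s
  | Write a x p' => a |: written p' (set_cell s a x)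
  end.

Fixpoint bind B C (p : program m w B) (f : B -> program m w C) :
  program m w C :=
  match p with
  | Return b => f b
  | Read a k => Read a (fun x => bind (k x) f)
  | Write a x p' => Write a x (bind p' f)
  end.

Lemma exec_bind B C (p : program m w B) (f : B -> program m w C) s :
  exec (bind p f) s =
  (result (f (result p s)) (final p s), final (f (result p s)) (final p s),
   cost p s + cost (f (result p s)) (final p s)).
Proof.
rewrite /result /final /cost.
elim: p s => [b|a k IH|a x p IH] s /=; first by case: exec => -[].
- by rewrite IH; case: (exec (k (s a)) s) => -[b s1] t /=; rewrite addSn.
- by rewrite IH; case: (exec p _) => -[b s1] t /=; rewrite addSn.
Qed.

Lemma written_bind B C (p : program m w B) (f : B -> program m w C) s :
  written (bind p f) s =
  written p s :|: written (f (result p s)) (final p s).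
Proof.
rewrite /result /final.
elim: p s => [b|a k IH|a x p IH] s /=; first by rewrite set0U.
- by rewrite IH; case: (exec (k (s a)) s) => -[].
- by rewrite IH setUA; case: (exec p _) => -[].
Qed.

Lemma exposed_bind B C (p : program m w B) (f : B -> program m w C) s :
  exposed (bind p f) s =
  exposed p s :|: exposed (f (result p s)) (final p s) :\: written p s.
Proof.
rewrite /result /final.
elim: p s => [b|a k IH|a x p IH] s /=; first by rewrite set0U setD0.
- by rewrite IH setUA; case: (exec (k (s a)) s) => -[].
- rewrite IH; case: (exec p _) => -[b s1] t /=.
  by apply/setP => c; rewrite !inE; case: (c == a); rewrite /= ?orbT ?andbF.
Qed.

Lemma card_exposed_le_cost B (p : program m w B) s :
  #|exposed p s| <= cost p s.
Proof.
rewrite /cost; elim: p s => [b|a k IH|a x p IH] s /=; first by rewrite cards0.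
- move: (IH (s a) s); case: (exec _ _) => -[b s1] t /= le.
  rewrite cardsU1 -add1n; apply: leq_add => //; exact: leq_b1.
- move: (IH (set_cell s a x)); case: (exec _ _) => -[b s1] t /= le.
  by apply: leqW; apply: leq_trans le; rewrite subset_leq_card ?subD1set.
Qed.

Lemma final_unwritten B (p : program m w B) s c :
  c \notin written p s -> final p s c = s c.
Proof.
rewrite /final; elim: p s => [b|a k IH|a x p IH] s //=.
- by move=> /IH; case: (exec _ _) => -[].
- rewrite in_setU1 negb_or => /andP[ca /IH]; case: (exec _ _) => -[b s1] t /= ->.
  by rewrite ffunE (negbTE ca).
Qed.

(** By induction on the program: a write makes both memories agree at its address, so a difference
    there stays invisible unless the cell was read earlier. *)
Lemma result_local B (p : program m w B) s s' :
  {in exposed p s, s =1 s'} -> result p s = result p s'.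
Proof.
rewrite /result; elim: p s s' => [b|a k IH|a x p IH] s s' //= eqs.
- rewrite -(eqs a); last by rewrite setU11.
  have /IH : {in exposed (k (s a)) s, s =1 s'}.
    by move=> c cF; apply: eqs; rewrite setU1r.
  by case: (exec _ s) => -[b s1] t /= ->; case: (exec _ s') => -[].
- have /IH : {in exposed p (set_cell s a x), set_cell s a x =1 set_cell s' a x}.
    move=> c cF; rewrite !ffunE; case: eqP => // /eqP ca; apply: eqs.
    by rewrite !inE ca.
  by case: (exec _ (set_cell s _ _)) => -[b s1] t /= ->; case: exec => -[].
Qed.

End Programs.

(** * Sequences of operations and information transfer along the tree *)

Section Operations.
Variables (q w : nat) (alg : algorithm q w).
Notation m := (cells alg).
Implicit Types (s : memory m w) (ds : seq 'I_q).

(** A whole block of operations is one program, so that [exposed], [written] and [result_local]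
    apply to blocks as they do to single operations. *)
Fixpoint ops ds : program m w (seq 'I_q) :=
  if ds is d :: ds' then
    bind (step alg d) (fun y => bind (ops ds') (fun ys => Return _ _ (y :: ys)))
  else Return _ _ [::].

Lemma run_fromE s ds :
  run_from s ds = (result (ops ds) s, cost (ops ds) s).
Proof.
elim: ds s => [|d ds IH] s //=.
rewrite /result /cost !exec_bind /= /result /final /cost /=.
case: (exec (step alg d) s) => -[y s1] t /=; rewrite exec_bind /= IH /cost /=.
by rewrite addn0.
Qed.

Lemma result_cons d ds s : result (ops (d :: ds)) s =
  result (step alg d) s :: result (ops ds) (final (step alg d) s).
Proof. by rewrite /result /= !exec_bind /= /result exec_bind. Qed.

Lemma final_cons d ds s : final (ops (d :: ds)) s =
  final (ops ds) (final (step alg d) s).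
Proof. by rewrite /final /= !exec_bind /= /final exec_bind. Qed.

Lemma cost_cons d ds s : cost (ops (d :: ds)) s =
  cost (step alg d) s + cost (ops ds) (final (step alg d) s).
Proof. by rewrite /cost /= !exec_bind /= /cost exec_bind /= addn0. Qed.

Lemma written_cons d ds s : written (ops (d :: ds)) s =
  written (step alg d) s :|: written (ops ds) (final (step alg d) s).
Proof. by rewrite /= !written_bind /= setU0. Qed.

Lemma exposed_cons d ds s : exposed (ops (d :: ds)) s =
  exposed (step alg d) s
    :|: exposed (ops ds) (final (step alg d) s) :\: written (step alg d) s.
Proof. by rewrite /= !exposed_bind /= set0D setU0. Qed.

Lemma final_cat ds1 ds2 s :
  final (ops (ds1 ++ ds2)) s = final (ops ds2) (final (ops ds1) s).
Proof.
elim: ds1 s => [|d ds1 IH] s //.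
by rewrite cat_cons !final_cons IH.
Qed.

Lemma result_cat ds1 ds2 s : result (ops (ds1 ++ ds2)) s =
  result (ops ds1) s ++ result (ops ds2) (final (ops ds1) s).
Proof.
elim: ds1 s => [|d ds1 IH] s //.
by rewrite cat_cons !result_cons final_cons IH.
Qed.

Lemma cost_cat ds1 ds2 s : cost (ops (ds1 ++ ds2)) s =
  cost (ops ds1) s + cost (ops ds2) (final (ops ds1) s).
Proof.
elim: ds1 s => [|d ds1 IH] s //.
by rewrite cat_cons !cost_cons final_cons IH addnA.
Qed.

Lemma exposed_cat ds1 ds2 s : exposed (ops (ds1 ++ ds2)) s =
  exposed (ops ds1) s
    :|: exposed (ops ds2) (final (ops ds1) s) :\: written (ops ds1) s.
Proof.
elim: ds1 s => [|d ds1 IH] s; first by rewrite /= set0U setD0.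
rewrite cat_cons !exposed_cons final_cons written_cons IH.
by rewrite setDUl setUA setDDl (setUC (written (step alg d) s)).
Qed.

Lemma size_result ds s : size (result (ops ds) s) = size ds.
Proof. by elim: ds s => // d ds IH s; rewrite result_cons /= IH. Qed.

Definition transferred L R s : {set 'I_m} :=
  exposed (ops R) (final (ops L) s) :&: written (ops L) s.

(* Sum of the information transfers over a complete binary tree of height [j]
   whose leaves are the operations [ds]. *)
Fixpoint tree_transfer j s ds : nat :=
  if j is i.+1 then
    let L := take (2 ^ i) ds in
    let R := drop (2 ^ i) ds in
    #|transferred L R s| + tree_transfer i s L
      + tree_transfer i (final (ops L) s) R
  else 0.

(* The cells exposed by both halves but written in between are exactly those
   that pass from the left half to the right half. *)
Lemma tree_transfer_le j s ds :
  tree_transfer j s ds + #|exposed (ops ds) s| <= cost (ops ds) s.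
Proof.
elim: j s ds => [|j IH] s ds /=; first exact: card_exposed_le_cost.
set L := take _ ds; set R := drop _ ds.
have -> : ds = L ++ R by rewrite cat_take_drop.
rewrite cost_cat exposed_cat.
have := IH s L; have := IH (final (ops L) s) R.
have := cardsID (written (ops L) s) (exposed (ops R) (final (ops L) s)).
rewrite -/(transferred L R s).
have := leq_card_setU (exposed (ops L) s)
  (exposed (ops R) (final (ops L) s) :\: written (ops L) s).
case=> /= + _; lia.
Qed.

End Operations.

(** Increasing the radius by one costs at most one more cell update. There are at most
    [1 + 2 ^ w * 2 ^ w <= 8 ^ w] choices: an address with a content, or no update ([None]). *)
Lemma card_hamming_ball m w (s : memory m w) k : 0 < w -> m <= 2 ^ w ->
  #|[set s' : memory m w | #|[set a | s' a != s a]| <= k]| <= (8 ^ w) ^ k.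
Proof.
move=> w0 mw; elim: k => [|k IH].
  rewrite expn0 -(cards1 s) subset_leq_card //; apply/subsetP => s'.
  rewrite !inE leqn0 cards_eq0 => /eqP e; apply/eqP/ffunP => a.
  by have := in_set0 a; rewrite -e inE => /negbFE/eqP.
set B := [set s' | _] in IH.
pose upd (u : memory m w * option ('I_m * word w)) :=
  if u.2 is Some (a, x) then set_cell u.1 a x else u.1.
apply: (@leq_trans #|[set upd u | u in setX B setT]|).
  apply: subset_leq_card; apply/subsetP => s'; rewrite inE => le.
  have [e|[a]] := set_0Vmem [set a | s' a != s a].
    by apply/imsetP; exists (s', None); rewrite // !inE e cards0.
  rewrite inE => ha; apply/imsetP.
  exists (set_cell s' a (s a), Some (a, s' a)).
    rewrite !inE andbT -ltnS; apply: leq_trans le; apply: proper_card.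
    apply/properP; split.
      by apply/subsetP => b; rewrite !inE ffunE; case: (b =P a) => // ->; rewrite eqxx.
    by exists a; rewrite !inE // ffunE eqxx eqxx.
  by apply/ffunP => b; rewrite !ffunE; case: eqP => // ->.
apply: leq_trans (leq_imset_card _ _) _.
rewrite cardsX cardsT card_option card_prod card_ord card_tuple card_bool.
rewrite expnSr; apply: leq_mul => //.
have -> : 8 ^ w = 2 ^ w * 2 ^ w * 2 ^ w by rewrite -!expnMn.
have : 2 <= 2 ^ w by rewrite -{1}(expn1 2) leq_exp2l.
nia.
Qed.

(** * Convolution outputs as windows of the input stream *)

Definition nats q (ds : seq 'I_q) : seq nat := [seq nat_of_ord y | y <- ds].

Lemma nth_nats q (x0 : 'I_q) (ds : seq 'I_q) i :
  i < size ds -> nth 0 (nats ds) i = nth x0 ds i.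
Proof. by move=> lt; rewrite (nth_map x0). Qed.

(** The successive arrays are the windows of length [n] of the stream [A ++ nats ds]. The window
    starts at [t.+1] because an operation shifts before it returns. *)
Lemma convolution_from_nth q n (V : n.-tuple 'I_q) A (ds : seq 'I_q) t :
  0 < n -> size A = n -> t < size ds ->
  nth 0 (convolution_from V A ds) t =
  (\sum_(i < n) nth 0 (A ++ nats ds) (t.+1 + i) * tnth V i) %% q.
Proof.
move=> n0; elim: ds A t => [|d ds IH] [|a A] [|t] //= szA; first by lia.
- by lia.
- move=> _; rewrite /inner; congr (_ %% q); apply: eq_bigr => i _.
  have : i <= size A by rewrite -ltnS szA.
  rewrite add0n nth_rcons nth_cat.
  by case: ltngtP => // -> _; rewrite subnn.
- rewrite ltnS => lt; rewrite IH ?size_rcons //; congr (_ %% q).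
  by apply: eq_bigr => i _; rewrite cat_rcons.
Qed.

Lemma sum_indicator (T : finType) (P Q : pred T) :
  \sum_(x | P x) Q x = #|[pred x | P x && Q x]|.
Proof. by rewrite -sum1_card big_mkcondr. Qed.

Lemma sum_window (M : nmodType) (f : nat -> M) b l n : b + l <= n ->
  (forall i, i < n -> ~~ (b <= i < b + l) -> f i = 0%R) ->
  (\sum_(i < n) f i = \sum_(j < l) f (b + j))%R.
Proof.
move=> le f0.
have sum0 a c : c <= n -> (c <= b) || (b + l <= a) ->
    (\sum_(a <= i < c) f i = 0)%R.
  move=> cn out; apply: big1_seq => i /=; rewrite mem_index_iota => ic.
  by apply: f0; lia.
rewrite -(big_mkord xpredT f) (big_cat_nat _ le) //=.
rewrite (big_cat_nat (leq0n b) (leq_addr l b)) /=.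
rewrite (sum0 0) ?leqnn ?(leq_trans (leq_addr _ _) le) // add0r.
rewrite (sum0 (b + l)) ?leqnn ?orbT // addr0.
rewrite -[X in index_iota X _]add0n big_addn addKn big_mkord.
by apply: eq_bigr => i _; rewrite addnC.
Qed.

(** * Kernels of random Toeplitz matrices *)

Section Toeplitz.
Variables (q n : nat).
Hypothesis q_prime : prime q.
Implicit Type V : n.-tuple 'I_q.

(** Working in the field ['F_q] allows a nonzero coefficient to be cancelled. *)
Definition entry V p : 'F_q := ((nth 0 (nats V) p)%:R)%R.

Lemma natr_Fp_inj a b : a < q -> b < q -> (a%:R = b%:R :> 'F_q)%R -> a = b.
Proof.
move=> aq bq /(congr1 (@nat_of_ord _)).
by rewrite !val_Fp_nat // !modn_small.
Qed.

Lemma natr_Fp_mod a : ((a %% q)%:R = a%:R :> 'F_q)%R.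
Proof. by apply: val_inj; rewrite /= !val_Fp_nat // modn_mod. Qed.

(* [x] is in the kernel if the inputs [x] on a block of [l] operations do not
   influence the outputs of the next [l] operations. *)
Definition toeplitz_ker l V : {set {ffun 'I_l -> 'F_q}} :=
  [set x : {ffun 'I_l -> 'F_q} | [forall r : 'I_l,
     \sum_(j < l) x j * entry V (n + j - (l + r).+1) == 0]]%R.

Lemma toeplitz_kerP l V (x : {ffun 'I_l -> 'F_q}) :
  reflect (forall r : nat, (r < l)%N ->
             \sum_(j < l) x j * entry V (n + j - (l + r).+1) = 0)%R
          (x \in toeplitz_ker l V).
Proof.
rewrite inE; apply: (iffP forallP) => [h r lt | h r].
  exact/eqP/(h (Ordinal lt)).
exact/eqP/h.
Qed.

(* If [j0] is the first nonzero index of [x], then [r] successive entries of [V]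
   are determined in turn by the [r] equations and by the other entries. *)
Lemma card_toeplitz_ker_contains l (x : {ffun 'I_l -> 'F_q}) :
  l + l <= n -> x != 0%R ->
  #|[set V | x \in toeplitz_ker l V]| <= q ^ (n - l).
Proof.
move=> ln x0.
have [j1 xj1] : exists j, x j != 0%R.
  apply/existsP; apply: contraR x0; rewrite negb_exists => /forallP h.
  by apply/eqP/ffunP => j; rewrite ffunE; apply/eqP; rewrite -[_ == _]negbK h.
case: (@arg_minnP _ j1 (fun j => x j != 0%R) (@nat_of_ord l) xj1) => j0 xj0 j0min {j1 xj1}.
have j0l := ltn_ord j0.
(* In equation [r], the coefficient [x j0] meets position [c + (l - r.+1)] of [V]. As [r] varies,
   these positions fill the window from [c] to [c + l - 1], and [f] erases that window. *)
pose c := n - (l + l) + j0.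
pose d0 : 'I_q := Ordinal (prime_gt0 q_prime).
pose f V : {ffun 'I_(n - l) -> 'I_q} :=
  [ffun i : 'I_(n - l) => nth d0 V (if i < c then i : nat else i + l)].
have -> : q ^ (n - l) = #|{ffun 'I_(n - l) -> 'I_q}| by rewrite card_ffun !card_ord.
rewrite -(@card_in_imset _ _ f); first exact: max_card.
move=> V V'; rewrite [V \in _]inE [V' \in _]inE => /toeplitz_kerP kV /toeplitz_kerP kV' fE.
have out p : p < n -> ~~ (c <= p < c + l) -> nth d0 V p = nth d0 V' p.
  move=> pn pc; have [lt|le] := ltnP p c.
    have pl : p < n - l by rewrite /c in lt; lia.
    by move/ffunP/(_ (Ordinal pl)): fE; rewrite !ffunE /= lt.
  have pl : p - l < n - l by lia.
  move/ffunP/(_ (Ordinal pl)): fE; rewrite !ffunE /=.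
  by rewrite ifF ?subnK //; lia.
have entry_eq p : p < n -> (nth d0 V p = nth d0 V' p) <-> (entry V p = entry V' p).
  move=> pn; rewrite /entry !(nth_nats d0) ?size_tuple //; split=> [-> //|].
  by move/natr_Fp_inj => e; apply/val_inj/e.
have win r : r < l -> nth d0 V (c + (l - r.+1)) = nth d0 V' (c + (l - r.+1)).
  elim/ltn_ind: r => r IH rl.
  have pE : c + (l - r.+1) = n + j0 - (l + r).+1 by rewrite /c; lia.
  have pn : c + (l - r.+1) < n by rewrite pE; lia.
  apply/entry_eq => //.
  have /eqP := etrans (kV r rl) (esym (kV' r rl)).
  (* Only the term of [j0] survives: [x j] vanishes for [j < j0], and for [j > j0] the entry lies
     past the window or was recovered from the earlier equation [r - (j - j0)]. *)
  rewrite -subr_eq0 -sumrB (bigD1 j0) //= big1 ?addr0 => [|j jj0].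
    by rewrite -mulrBr mulf_eq0 (negbTE xj0) subr_eq0 -pE => /eqP.
  have [->|xj] := eqVneq (x j) 0%R; first by rewrite !mul0r subrr.
  have j0j : j0 < j.
    by rewrite ltn_neqAle j0min // andbT eq_sym.
  have jl := ltn_ord j.
  suff -> : entry V (n + j - (l + r).+1) = entry V' (n + j - (l + r).+1).
    exact: subrr.
  have pn' : n + j - (l + r).+1 < n by lia.
  apply/entry_eq => //.
  have [lt|le] := ltnP (n + j - (l + r).+1) (c + l); last by apply: out => //; lia.
  have -> : n + j - (l + r).+1 = c + (l - (r - (j - j0)).+1).
    by rewrite /c in lt *; lia.
  by apply: IH; rewrite /c in lt *; lia.
apply/val_inj/(@eq_from_nth _ d0) => [|p]; rewrite ?size_tuple // => pn.
have [/andP[cp pc]|] := boolP (c <= p < c + l); last exact: out.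
have -> : p = c + (l - (l - (p - c).+1).+1) by lia.
by apply: win; lia.
Qed.

(** Double counting of the pairs of a [V] and a nonzero kernel vector; the predecessors discard the
    zero vector. *)
Lemma sum_card_toeplitz_ker l : l + l <= n ->
  \sum_V (#|toeplitz_ker l V|).-1 <= (q ^ l).-1 * q ^ (n - l).
Proof.
move=> ln.
have -> : \sum_V (#|toeplitz_ker l V|).-1 =
    \sum_V \sum_(x : {ffun 'I_l -> 'F_q} | x != 0%R) (x \in toeplitz_ker l V).
  apply: eq_bigr => V _; rewrite sum_indicator.
  pose z : {ffun 'I_l -> 'F_q} := 0%R.
  have zker : z \in toeplitz_ker l V.
    by apply/toeplitz_kerP => r _; rewrite big1 // => j _; rewrite ffunE mul0r.
  rewrite (cardsD1 z) zker /=.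
  by apply: eq_card => x; rewrite !inE.
rewrite exchange_big /=.
apply: (@leq_trans (\sum_(x : {ffun 'I_l -> 'F_q} | x != 0%R) q ^ (n - l))).
  apply: leq_sum => x x0; rewrite sum_indicator.
  apply: leq_trans (card_toeplitz_ker_contains ln x0).
  by rewrite subset_leq_card //; apply/subsetP => V; rewrite !inE.
rewrite sum_nat_const leq_mul2r; apply/orP; right.
have -> : (q ^ l).-1 = #|predC1 (0%R : {ffun 'I_l -> 'F_q})|.
  by rewrite cardC1 card_ffun !card_ord Fp_cast.
by [].
Qed.

(* The kernel is at most half-dimensional, so that at least [q ^ (l / 2)]
   different output sequences can occur. *)
Definition well_conditioned l V := #|toeplitz_ker l V| ^ 2 <= q ^ l.

(** Markov's inequality applied to the number of nonzero kernel vectors. *)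
Lemma card_well_conditioned l : 0 < l -> l + l <= n ->
  q ^ n <= 16 * #|[set V | well_conditioned l V]|.
Proof.
move=> l0 ln.
have q2 := prime_gt1 q_prime.
have x2 : 2 <= q ^ l.
  by apply: (leq_trans q2); rewrite -{1}[q]expn1 (leq_exp2l _ _ q2).
have qn : q ^ n = q ^ l * q ^ (n - l) by rewrite -expnD subnKC //; lia.
have cardV : #|[set V | well_conditioned l V]| +
    #|[set V | ~~ well_conditioned l V]| = q ^ n.
  rewrite -[X in X ^ n](card_ord q) -card_tuple -(cardsC [set V | well_conditioned l V]).
  by congr (_ + _); apply: eq_card => V; rewrite !inE.
have bound d : (forall V, ~~ well_conditioned l V -> d < #|toeplitz_ker l V|) ->
    #|[set V | ~~ well_conditioned l V]| * d <= (q ^ l).-1 * q ^ (n - l).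
  move=> h; apply: leq_trans (sum_card_toeplitz_ker ln).
  rewrite -sum_nat_const [X in _ <= X](bigID [pred V | ~~ well_conditioned l V]) /=.
  apply: leq_trans (leq_addr _ _).
  rewrite (eq_bigl (fun V => ~~ well_conditioned l V)); last by move=> V; rewrite inE.
  by apply: leq_sum => V /h; case: #|_|.
have big k V : k ^ 2 <= q ^ l -> ~~ well_conditioned l V -> k < #|toeplitz_ker l V|.
  move=> kx; rewrite -ltnNge => /(leq_ltn_trans kx).
  by rewrite ltn_exp2r.
move: (q ^ l) (q ^ (n - l)) x2 qn big bound => x y x2 qn big bound.
move: cardV; rewrite qn.
(* If [x < 16], a bad [V] has at least one nonzero kernel vector, which leaves at least [y] good
   ones out of [x * y]. If [x >= 16], it has at least 4, so fewer than a quarter are bad. *)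
have [lt|le] := ltnP x 16.
  have := bound 1 (fun V => big 1 V (ltnW x2)).
  case: (x) lt x2 => [//|x'] /=; rewrite muln1 => lt _; nia.
have := bound 4 (fun V => big 4 V le).
by case: (x) x2 => [//|x'] _ /=; nia.
Qed.

End Toeplitz.

Lemma card_le_imset_mul (aT rT : finType) (f : aT -> rT) (S : {set aT}) K :
  (forall x, x \in S -> #|[set y in S | f y == f x]| <= K) ->
  #|S| <= #|f @: S| * K.
Proof.
move=> fib; rewrite -sum1_card (partition_big_imset f) /= -sum_nat_const.
apply: leq_sum => _ /imsetP[x xS ->]; rewrite sum1_card.
apply: leq_trans (fib x xS); rewrite subset_leq_card //.
by apply/subsetP => y; rewrite !inE.
Qed.

(** * Information transfer at one node of the tree *)

Section Node.
Variables (q n w : nat) (alg : algorithm q w) (V : n.-tuple 'I_q).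
Hypotheses (q_prime : prime q) (w_gt0 : 0 < w) (algV : solves alg V).
Notation m := (cells alg).

Lemma nth_output (ds : seq 'I_q) t : size ds <= n -> t < size ds ->
  nth 0 (nats (result (ops alg ds) (init alg))) t =
  (\sum_(i < n) nth 0 (nseq n 0 ++ nats ds) (t.+1 + i) * tnth V i) %% q.
Proof.
move=> dsn tds.
pose d0 : 'I_q := Ordinal (prime_gt0 q_prime).
(* Correctness is assumed only for [n] inputs, so a shorter sequence is padded; output [t] does not
   see the padding. *)
pose D := ds ++ nseq (n - size ds) d0.
have szD : size D == n by rewrite size_cat size_nseq subnKC.
have := algV (Tuple szD); rewrite /outputs /run run_fromE /= => /(congr1 (nth 0 ^~ t)).
rewrite /convolution convolution_from_nth ?size_nseq //; last 2 first.
- by lia.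
- by rewrite (eqP szD); lia.
rewrite /D result_cat map_cat nth_cat size_map size_result tds => ->.
congr (_ %% q); apply: eq_bigr => i _.
have := ltn_ord i => ilt.
rewrite /nats map_cat catA nth_cat size_cat size_nseq size_map ifT //; lia.
Qed.

Variables (l : nat) (P : seq 'I_q) (Rt : l.-tuple 'I_q).
Hypothesis room : size P + (l + l) <= n.

Notation s0 := (final (ops alg P) (init alg)).
Notation out L := (result (ops alg Rt) (final (ops alg L) s0)).

Lemma nth_out (L : l.-tuple 'I_q) (r : nat) : r < l ->
  ((nth 0 (nats (out L)) r)%:R : 'F_q)%R =
  (\sum_(i < n) (nth 0%N (nseq n 0%N ++ nats (P ++ L ++ Rt))
     ((size P + l + r).+1 + i))%:R * entry V i)%R.
Proof.
move=> rl.
have := @nth_output (P ++ L ++ Rt) (size P + l + r).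
rewrite !size_cat !size_tuple => /(_ _ _)/[!result_cat].
rewrite /nats !map_cat !nth_cat !size_map !size_result size_tuple -/(nats _).
rewrite ifF ?ifF; try lia.
have -> : size P + l + r - size P - l = r by lia.
move=> ->; try lia.
rewrite natr_Fp_mod // natr_sum; apply: eq_bigr => i _.
by rewrite natrM /entry (nth_nats (tnth V i)) ?size_tuple // -tnth_nth.
Qed.

(** Outputs are linear in the inputs, so if [L] and [L0] give the same outputs, the common parts [P]
    and [Rt] cancel and [L - L0] lies in the kernel. *)
Lemma card_out_fiber (L0 : l.-tuple 'I_q) :
  #|[set L : l.-tuple 'I_q | out L == out L0]| <= #|toeplitz_ker l V|.
Proof.
pose f (L : l.-tuple 'I_q) : {ffun 'I_l -> 'F_q} :=
  [ffun j : 'I_l => (tnth L j)%:R - (tnth L0 j)%:R]%R.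
have f_inj : injective f.
  move=> L L' /ffunP fE; apply: eq_from_tnth => j; apply: val_inj.
  have := fE j; rewrite !ffunE => /addIr /natr_Fp_inj; exact.
rewrite -(card_imset _ f_inj) subset_leq_card //.
apply/subsetP => _ /imsetP[L + ->]; rewrite inE => /eqP outE.
apply/toeplitz_kerP => r rl.
pose X (L : l.-tuple 'I_q) := nseq n 0 ++ nats (P ++ L ++ Rt).
pose g i : 'F_q := (((nth 0%N (X L) ((size P + l + r).+1 + i))%:R -
  (nth 0%N (X L0) ((size P + l + r).+1 + i))%:R) * entry V i)%R.
have XE (M : l.-tuple 'I_q) i : n <= (size P + l + r).+1 + i ->
    nth 0 (X M) ((size P + l + r).+1 + i) =
    nth 0 (nats (P ++ M ++ Rt)) ((size P + l + r).+1 + i - n).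
  by move=> le; rewrite nth_cat size_nseq ltnNge le.
have bl : n - (l + r).+1 + l <= n by lia.
(* Outside this window, [V] is multiplied by initial zeros or by inputs from [P] or [Rt], which are
   the same on both sides. *)
have g0 i : i < n -> ~~ (n - (l + r).+1 <= i < n - (l + r).+1 + l) -> g i = 0%R.
  move=> ilt iout; rewrite /g.
  suff -> : nth 0 (X L) ((size P + l + r).+1 + i) =
    nth 0 (X L0) ((size P + l + r).+1 + i) by rewrite subrr mul0r.
  have [le|lt] := leqP n ((size P + l + r).+1 + i); last first.
    by rewrite !nth_cat size_nseq lt.
  rewrite !XE //; set k := _ - n.
  rewrite /nats !map_cat !nth_cat !size_map !size_tuple.
  case: ltnP => // kP.
  by have -> : (k - size P < l) = false by rewrite /k in kP *; lia.
transitivity (\sum_(i < n) g i)%R; last first.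
  rewrite /g; under eq_bigr do rewrite mulrBl.
  by rewrite sumrB -!nth_out // outE subrr.
rewrite (sum_window bl g0); apply: eq_bigr => j _; rewrite ffunE /g.
have jl := ltn_ord j.
have -> : n + j - (l + r).+1 = n - (l + r).+1 + j by lia.
congr ((_ - _) * _)%R; congr (_%:R)%R.
all: rewrite XE; last by lia.
all: have -> : (size P + l + r).+1 + (n - (l + r).+1 + j) - n = size P + j by lia.
all: rewrite /nats !map_cat !nth_cat !size_map !size_tuple ifF; last by lia.
all: by rewrite addKn jl (nth_map (tnth L j)) ?size_tuple // -tnth_nth.
Qed.

(* The outputs after [L] depend on [L] only through the contents of the
   transferred cells. *)
Lemma out_simulation (L : seq 'I_q) :
  out L = result (ops alg Rt)
    [ffun a => if a \in transferred L Rt s0 then final (ops alg L) s0 a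
               else s0 a].
Proof.
apply: result_local => a aF; rewrite ffunE inE aF /=.
by case: ifPn => // /final_unwritten.
Qed.

Lemma card_few_transferred k : well_conditioned l V -> 0 < l ->
  (8 ^ w) ^ (3 * k) <= q ^ l ->
  2 * #|[set L : l.-tuple 'I_q | #|transferred L Rt s0| <= k]| <= q ^ l.
Proof.
rewrite /well_conditioned => KQ l0 MQ; set S := [set L : l.-tuple 'I_q | _].
pose seen (L : l.-tuple 'I_q) : memory m w :=
  [ffun a => if a \in transferred L Rt s0 then final (ops alg L) s0 a
             else s0 a].
(* The memories [seen L] with [L] in [S] lie in the ball of radius [k] around [s0], and inputs with
   the same [seen] have the same outputs. *)
have leS : #|S| <= (8 ^ w) ^ k * #|toeplitz_ker l V|.
  apply: (@leq_trans (#|seen @: S| * #|toeplitz_ker l V|)).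
    apply: card_le_imset_mul => L0 _; apply: leq_trans (card_out_fiber L0).
    apply: subset_leq_card; apply/subsetP => L; rewrite !inE => /andP[_ /eqP e].
    by rewrite !out_simulation -/(seen L) e.
  rewrite leq_mul2r; apply/orP; right.
  apply: leq_trans (card_hamming_ball s0 k w_gt0 (cells_le alg)).
  apply: subset_leq_card; apply/subsetP => _ /imsetP[L + ->].
  rewrite !inE; apply: leq_trans; apply: subset_leq_card; apply/subsetP => a.
  by rewrite inE ffunE; case: ifP => //; rewrite eqxx.
have x2 : 2 <= q ^ l.
  apply: (leq_trans (prime_gt1 q_prime)).
  by rewrite -{1}[q]expn1 (leq_exp2l _ _ (prime_gt1 q_prime)).
apply: (@leq_trans (2 * ((8 ^ w) ^ k * #|toeplitz_ker l V|))).
  by rewrite leq_mul2l leS.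
move: KQ MQ x2; move: (#|toeplitz_ker l V|) (q ^ l) => K x KQ.
(* With [M = (8 ^ w) ^ k], the goal is [2 * M * K <= x]. For [k > 0], squaring gives
   [4 * M ^ 2 * K ^ 2 <= M ^ 3 * x <= x ^ 2] since [M >= 8]. For [k = 0], [M = 1] and the bound
   follows from [K ^ 2 <= x] and [x >= 2]. *)
have [->|k0] := posnP k.
  by rewrite muln0 !expn0 => _; case: K KQ => [|[|K]] KQ x2; nia.
have : 8 <= (8 ^ w) ^ k.
  by rewrite -expnM -{1}[8]expn1 leq_exp2l // muln_gt0 w_gt0.
rewrite [3 * k]mulnC expnM; move: ((8 ^ w) ^ k) => M M8 MQ x2.
rewrite -(@leq_exp2r _ _ 2) // !expnMn.
apply: (@leq_trans (M ^ 3 * x)); last by rewrite -[x ^ 2]mulnn leq_mul2r MQ orbT.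
by rewrite mulnA leq_mul //; nia.
Qed.

End Node.

(** * Logarithms and averages over the inputs and the tree *)

Local Open Scope ring_scope.

Lemma log2_natX (R : realType) (a b : nat) : (0 < a)%N ->
  log2 ((a ^ b)%N%:R : R) = b%:R * log2 (a%:R : R).
Proof.
by move=> a0; rewrite /log2 natrX lnXn ?ltr0n // -[ln _ *+ _]mulr_natl mulrA.
Qed.

Lemma log2_two (R : realType) : log2 (2%:R : R) = 1.
Proof. by rewrite /log2 divff // gt_eqF // ln_gt0 // ltr1n. Qed.

Lemma ler_log2_nat (R : realType) (a b : nat) : (0 < a)%N -> (a <= b)%N ->
  log2 (a%:R : R) <= log2 (b%:R : R).
Proof.
move=> a0 ab; rewrite /log2 ler_pM2r ?invr_gt0 ?ln_gt0 ?ltr1n //.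
by rewrite ler_ln ?posrE ?ltr0n ?ler_nat // (leq_trans a0).
Qed.

Lemma sum_tuple_cat (M : nmodType) (T : finType) a b (f : seq T -> M) :
  \sum_(D : (a + b).-tuple T) f D =
  \sum_(L : a.-tuple T) \sum_(Rt : b.-tuple T) f (L ++ Rt).
Proof.
pose h (p : a.-tuple T * b.-tuple T) : (a + b).-tuple T := cat_tuple p.1 p.2.
have h_inj : injective h.
  move=> [L1 R1] [L2 R2] /(congr1 val) /= /eqP.
  by rewrite eqseq_cat ?size_tuple // => /andP[/eqP/val_inj -> /eqP/val_inj ->].
have h_bij : bijective h.
  by apply: inj_card_bij h_inj _; rewrite card_prod !card_tuple expnD.
rewrite (reindex h (onW_bij _ h_bij)).
by rewrite (pair_bigA _ (fun (L : a.-tuple T) (Rt : b.-tuple T) => f (L ++ Rt))).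
Qed.

Section Average.
Variables (R : realType) (q n w : nat) (V : n.-tuple 'I_q) (alg : algorithm q w).
Hypotheses (q_prime : prime q) (w_gt0 : (0 < w)%N) (algV : solves alg V).

Local Notation delta := (log2 (q%:R : R)).

Lemma log2_q_ge0 : 0 <= delta.
Proof.
rewrite /log2 divr_ge0 ?ln_ge0 ?ler1n //; exact: prime_gt0.
Qed.

Lemma sum_transferred_ge l (P : seq 'I_q) (Rt : l.-tuple 'I_q) :
  (0 < l)%N -> (size P + (l + l) <= n)%N -> well_conditioned l V ->
  (q ^ l)%:R * (l%:R * (delta / (18 * w%:R))) <=
  \sum_(L : l.-tuple 'I_q)
     #|transferred L Rt (final (ops alg P) (init alg))|%:R :> R.
Proof.
move=> l0 room good.
set s := final _ _.
have wR : 0 < w%:R :> R by rewrite ltr0n.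
have B1 : (1 < (8 ^ w) ^ 3)%N.
  rewrite -expnM -[1%N](expn0 8) ltn_exp2l //; lia.
have x0 : (0 < q ^ l)%N by rewrite expn_gt0 prime_gt0.
(* The largest [k] allowed by [card_few_transferred]. Maximality gives [q ^ l < 2 ^ (9 * w * k.+1)],
   where 9 is 3 from [8 = 2 ^ 3] times 3 from the cube. *)
set k := trunc_log ((8 ^ w) ^ 3) (q ^ l).
have kle : ((8 ^ w) ^ (3 * k) <= q ^ l)%N by rewrite expnM trunc_logP.
have klt : l%:R * delta <= (9 * w * k.+1)%N%:R.
  rewrite -[leRHS]mulr1 -[X in _ <= _ * X](log2_two R).
  rewrite -(log2_natX _ _ (prime_gt0 q_prime)) -(@log2_natX R 2) //.
  apply: ler_log2_nat => //; apply: ltnW.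
  have -> : (2 ^ (9 * w * k.+1) = ((8 ^ w) ^ 3) ^ k.+1)%N.
    by rewrite -[8%N]/(2 ^ 3)%N -!expnM; congr (_ ^ _)%N; lia.
  exact: trunc_log_ltn.
have half := card_few_transferred q_prime w_gt0 algV Rt room good l0 kle.
set S := [set L : l.-tuple 'I_q | _] in half.
(* At least half of the [L] lie outside [S], which turns 9 into 18. *)
apply: (@le_trans _ _ (\sum_(L in ~: S) k.+1%:R)).
  rewrite sumr_const -[leRHS]mulr_natl.
  have : (q ^ l)%N%:R <= 2 * #|~: S|%:R :> R.
    have := cardsC S; rewrite card_tuple card_ord => eqS.
    by rewrite -natrM ler_nat -eqS; rewrite -eqS in half; lia.
  move: klt; rewrite !natrM => klt le2.
  have := log2_q_ge0 => d0.
  apply: (@le_trans _ _ (2 * #|~: S|%:R * (l%:R * (delta / (18 * w%:R))))).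
    apply: ler_wpM2r le2; apply: mulr_ge0 => //; apply: divr_ge0 => //.
    exact: mulr_ge0.
  have -> : 2 * #|~: S|%:R * (l%:R * (delta / (18 * w%:R))) =
      #|~: S|%:R * ((l%:R * delta) / (9 * w%:R)).
    by field; rewrite gt_eqF.
  apply: ler_wpM2l => //; rewrite ler_pdivrMr ?mulr_gt0 // [leRHS]mulrC.
  exact: klt.
rewrite [leRHS](bigID (mem (~: S))) /=.
rewrite -[leLHS]addr0; apply: lerD; last exact: sumr_ge0.
by apply: ler_sum => L; rewrite !inE -ltnNge ler_nat.
Qed.

(** Induction on the height. The prefix [P] is arbitrary because the right subtree starts after
    [P ++ L]. The constant is 36 since a node with halves of size [l] covers [2 * l] operations. *)
Lemma sum_tree_transfer_ge j (P : seq 'I_q) : (size P + 2 ^ j <= n)%N ->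
  (q ^ (2 ^ j))%:R * ((2 ^ j)%:R * (delta / (36 * w%:R)) *
     \sum_(i < j) (well_conditioned (2 ^ i) V)%:R) <=
  \sum_(D : (2 ^ j).-tuple 'I_q)
     (tree_transfer j (final (ops alg P) (init alg)) D)%:R :> R.
Proof.
elim: j P => [|j IH] P room.
  by rewrite big_ord0 !mulr0 sumr_ge0.
rewrite big_ord_recr /=; set g := \sum_(i < j) _; rewrite -/g in IH.
set s := final _ _.
move: room; rewrite expnS mul2n -addnn; set l := (2 ^ j)%N => room.
have l0 : (0 < l)%N by rewrite expn_gt0.
set c := delta / _.
rewrite (@sum_tuple_cat _ _ l l (fun D => (tree_transfer j.+1 s D)%:R)).
have -> : \sum_(L : l.-tuple 'I_q) \sum_(Rt : l.-tuple 'I_q)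
    (tree_transfer j.+1 s (L ++ Rt))%:R =
  (\sum_(Rt : l.-tuple 'I_q) \sum_(L : l.-tuple 'I_q) #|transferred L Rt s|%:R)
  + (\sum_(L : l.-tuple 'I_q) \sum_(Rt : l.-tuple 'I_q) (tree_transfer j s L)%:R)
  + \sum_(L : l.-tuple 'I_q) \sum_(Rt : l.-tuple 'I_q)
      (tree_transfer j (final (ops alg L) s) Rt)%:R :> R.
  rewrite [X in X + _ + _]exchange_big -!big_split; apply: eq_bigr => L _.
  rewrite -!big_split; apply: eq_bigr => Rt _ /=.
  by rewrite -/l take_size_cat ?drop_size_cat ?size_tuple // !natrD.
have cardT : #|{: l.-tuple 'I_q}| = (q ^ l)%N by rewrite card_tuple card_ord.
set x : R := (q ^ l)%:R.
have x0 : 0 <= x by [].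
(* The transfer at the root is bounded for each fixed [Rt]; if [V] is not well conditioned at this
   scale, the lower bound is 0. *)
have le1 : x * (x * (l%:R * (2 * c) * (well_conditioned l V)%:R)) <=
    \sum_(Rt : l.-tuple 'I_q) \sum_(L : l.-tuple 'I_q) #|transferred L Rt s|%:R.
  rewrite /x -{1}cardT mulr_natl -sumr_const; apply: ler_sum => Rt _.
  have [good|_] := boolP (well_conditioned l V); last first.
    by rewrite !mulr0 sumr_ge0.
  apply: le_trans (sum_transferred_ge Rt l0 room good).
  rewrite mulr1 ler_wpM2l // ler_wpM2l //.
  rewrite le_eqVlt; apply/orP; left; apply/eqP; rewrite /c; field.
  by rewrite pnatr_eq0 -lt0n.
have le2 : x * (x * (l%:R * c * g)) <=
    \sum_(L : l.-tuple 'I_q) \sum_(Rt : l.-tuple 'I_q) (tree_transfer j s L)%:R.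
  rewrite exchange_big /= sumr_const cardT -[leRHS]mulr_natl -/x.
  by apply: ler_wpM2l => //; apply: IH; lia.
have le3 : x * (x * (l%:R * c * g)) <=
    \sum_(L : l.-tuple 'I_q) \sum_(Rt : l.-tuple 'I_q)
      (tree_transfer j (final (ops alg L) s) Rt)%:R.
  rewrite {1}/x -{1}cardT mulr_natl -sumr_const; apply: ler_sum => L _.
  by rewrite /s -final_cat; apply: IH; rewrite size_cat size_tuple; lia.
apply: le_trans (lerD (lerD le1 le2) le3).
rewrite le_eqVlt; apply/orP; left; apply/eqP.
by rewrite expnD natrM natrD -/x; ring.
Qed.

End Average.

Theorem theorem2 (R : realType) :
  exists c : R, 0 < c /\
    forall (q n w : nat) (alg : n.-tuple 'I_q -> algorithm q w),
      prime q ->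
      (exists k : nat, n = (2 ^ k)%N) ->
      (0 < w)%N ->
      (forall V : n.-tuple 'I_q, solves (alg V) V) ->
      c * (log2 (q%:R : R) / w%:R * n%:R * log2 (n%:R : R))
        <= expected_time R alg.
Proof.
(* [576 = 36 * 16]: the loss in [sum_tree_transfer_ge] times the loss in [card_well_conditioned]. *)
exists 576^-1; split; first by rewrite invr_gt0.
move=> q n w alg q_prime [k nE] w0 algV.
have wR : 0 < w%:R :> R by rewrite ltr0n.
have d0 := log2_q_ge0 R q_prime.
set delta := log2 (q%:R : R) in d0 *.
have cardT : #|{: n.-tuple 'I_q}| = (q ^ n)%N by rewrite card_tuple card_ord.
have qn : 0 < (q ^ n)%:R :> R by rewrite ltr0n expn_gt0 prime_gt0.
rewrite /expected_time cardT natrM ler_pdivlMr ?mulr_gt0 //.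
have logn : log2 (n%:R : R) = k%:R by rewrite nE log2_natX // log2_two mulr1.
rewrite logn.
set x : R := (q ^ n)%:R in qn *.
set c : R := x * (n%:R * (delta / (36 * w%:R))).
have c0 : 0 <= c.
  apply: mulr_ge0; first exact: ltW.
  by apply: mulr_ge0 => //; apply: divr_ge0 => //; apply: mulr_ge0.
apply: (@le_trans _ _ (\sum_(V : n.-tuple 'I_q)
    c * \sum_(i < k) (well_conditioned (2 ^ i) V)%:R)); last first.
  apply: ler_sum => V _.
  apply: (@le_trans _ _ (\sum_(D : n.-tuple 'I_q)
      (tree_transfer k (init (alg V)) D)%:R)).
    have := @sum_tree_transfer_ge R q n w V (alg V) q_prime w0 (algV V) k [::].
    by rewrite add0n -nE leqnn mulrA => /(_ isT).
  apply: ler_sum => D _; rewrite ler_nat /time /run run_fromE /=.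
  exact: leq_trans (leq_addr _ _) (tree_transfer_le k _ _).
(* No single [V] need be well conditioned at all scales: exchanging the sums allows a different set
   of good [V] at each level. *)
rewrite -mulr_sumr exchange_big /=.
apply: (@le_trans _ _ (c * \sum_(i < k) (x / 16))); last first.
  apply: ler_wpM2l => //; apply: ler_sum => i _.
  rewrite ler_pdivrMr // mulrC -natr_sum sum_indicator -natrM ler_nat.
  have ik : (2 ^ i + 2 ^ i <= n)%N.
    by rewrite addnn -mul2n -expnS nE leq_exp2l.
  have := card_well_conditioned q_prime (_ : 0 < 2 ^ i)%N ik.
  rewrite expn_gt0 => /(_ isT)/leq_trans; apply.
  rewrite leq_mul2l; apply/orP; right; apply: subset_leq_card.
  by apply/subsetP => V; rewrite !inE.
rewrite sumr_const card_ord -[X in c * X]mulr_natl /c.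
rewrite le_eqVlt; apply/orP; left; apply/eqP; field.
by rewrite gt_eqF.
Qed.
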